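(* Let $\mathbb{KC}=((G,R),(M,S),I)$ be a Kripke context based on the context $\mathbb{K}=(G,M,I)$. For all $x,y\in\mathfrak{P}(\mathbb{K})$, the following hold. 1. $f_{R}(x\sqcap y)=f_{R}(x)\sqcap f_{R}(y)$ and $f_{S}(x\sqcup y)=f_{S}(x)\sqcup f_{S}(y)$. 2. $f_{R}(x\sqcap x)=f_{R}(x)$ and $f_{S}(x\sqcup x)=f_{S}(x)$. 3. $f_{R}(\neg\bot)=\neg\bot$ and $f_{S}(\lrcorner\top)=\lrcorner\top$. 4. $f_{R}(\neg x)=\neg f_{R}^{\delta}(x)$ and $f_{S}(\lrcorner x)=\lrcorner f_{S}^{\delta}(x)$.
   Context: A context is $\mathbb{K}=(G,M,I)$ with $G,M$ sets and $I\subseteq G\times M$. For $A\subseteq G$, $A':=\{m\in M: gIm\text{ for all }g\in A\}$; for $B\subseteq M$, $B':=\{g\in G: gIm\text{ for all }m\in B\}$. A protoconcept of $\mathbb{K}$ is a pair $(A,B)$, $A\subseteq G$, $B\subseteq M$, with $A''=B'$ (equivalently $A'=B''$); $\mathfrak{P}(\mathbb{K})$ is the set of protoconcepts. Operations on $\mathfrak{P}(\mathbb{K})$: $(A_1,B_1)\sqcap(A_2,B_2):=(A_1\cap A_2,(A_1\cap A_2)')$, $(A_1,B_1)\sqcup(A_2,B_2):=((B_1\cap B_2)',B_1\cap B_2)$, $\neg(A,B):=(G\setminus A,(G\setminus A)')$, $\lrcorner(A,B):=((M\setminus B)',M\setminus B)$, $\top:=(G,\emptyset)$, $\bot:=(\emptyset,M)$.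 A Kripke context based on $\mathbb{K}$ is $\mathbb{KC}=((G,R),(M,S),I)$ with $R$, $S$ arbitrary binary relations on $G$, $M$. For a binary relation $E$ on $W$ and $A\subseteq W$, $\underline{A}_E:=\{x\in W:\forall y\,(xEy\Rightarrow y\in A)\}$. For $(A,B)\in\mathfrak{P}(\mathbb{K})$, $f_R((A,B)):=(\underline{A}_R,(\underline{A}_R)')$ and $f_S((A,B)):=((\underline{B}_S)',\underline{B}_S)$; these are maps $\mathfrak{P}(\mathbb{K})\to\mathfrak{P}(\mathbb{K})$. Their duals are $f_R^\delta(x):=\neg f_R(\neg x)$ and $f_S^\delta(x):=\lrcorner f_S(\lrcorner x)$. *)

(* Defs.v *)
From mathcomp Require Import all_boot.
From mathcomp Require Import boolp classical_sets.

Set Implicit Arguments.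
Unset Strict Implicit.
Unset Printing Implicit Defensive.

Local Open Scope classical_set_scope.

(* The sets G and M are the carrier types [obj] and [attr]; either may be
   empty. *)
Record context := Context {
  obj : Type;
  attr : Type;
  incid : obj -> attr -> Prop }.

Section Derivation.
Variable K : context.

Definition intent (A : set (obj K)) : set (attr K) :=
  [set m | forall g, A g -> incid g m].

Definition extent (B : set (attr K)) : set (obj K) :=
  [set g | forall m, B m -> incid g m].

Lemma extentK (B : set (attr K)) : extent (intent (extent B)) = extent B.
Proof.
apply/seteqP; split=> g /= gB m Bm; first by apply: gB => h; apply.
exact: Bm.
Qed.

Lemma extent_intent_setT : extent (intent [set: obj K]) = extent set0.
Proof. by apply/seteqP; split=> g _ m //= ; apply. Qed.

Lemma extent_intent_set0 : extent (intent set0) = extent [set: attr K].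
Proof. by congr extent; apply/seteqP; split=> m _ // g []. Qed.

End Derivation.

(* Leibniz equality of protoconcepts is equality of both components, by proof
   irrelevance for [protoP]. *)
Record protoconcept (K : context) := Protoconcept {
  pext : set (obj K);
  pint : set (attr K);
  protoP : extent (intent pext) = extent pint }.

Section Operations.
Variable K : context.
Implicit Types x y : protoconcept K.

Definition proto_of_ext (A : set (obj K)) : protoconcept K :=
  @Protoconcept K A (intent A) erefl.

Definition proto_of_int (B : set (attr K)) : protoconcept K :=
  @Protoconcept K (extent B) B (extentK B).

Definition pmeet x y : protoconcept K := proto_of_ext (pext x `&` pext y).

Definition pjoin x y : protoconcept K := proto_of_int (pint x `&` pint y).

Definition pneg x : protoconcept K := proto_of_ext (~` pext x).

Definition popp x : protoconcept K := proto_of_int (~` pint x).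

Definition ptop : protoconcept K :=
  @Protoconcept K setT set0 (extent_intent_setT K).

Definition pbot : protoconcept K :=
  @Protoconcept K set0 setT (extent_intent_set0 K).

End Operations.

Record kripke_context (K : context) := KripkeContext {
  relG : obj K -> obj K -> Prop;
  relM : attr K -> attr K -> Prop }.

Definition lower_approx (W : Type) (E : W -> W -> Prop) (A : set W) : set W :=
  [set x | forall y, E x y -> A y].

Section KripkeOperators.
Variables (K : context) (KC : kripke_context K).
Implicit Types x : protoconcept K.

Definition fR x : protoconcept K :=
  proto_of_ext (lower_approx (relG KC) (pext x)).

Definition fS x : protoconcept K :=
  proto_of_int (lower_approx (relM KC) (pint x)).

Definition fR_dual x : protoconcept K := pneg (fR (pneg x)).

Definition fS_dual x : protoconcept K := popp (fS (popp x)).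

End KripkeOperators.

Arguments ptop : clear implicits.
Arguments pbot : clear implicits.

(* Main.v *)
Require Import Defs.
From mathcomp Require Import all_boot.
From mathcomp Require Import boolp classical_sets.

(** The operations [pmeet], [pneg], [fR] read only the extent of their arguments
    and return the semiconcept [proto_of_ext] of a set of objects, while [pjoin],
    [popp], [fS] do the same with the intent and [proto_of_int]. Since every
    equation has such a semiconcept on both sides, it reduces to an equality of
    sets: the lower approximation is the box operator of a Kripke frame, and the
    identities are that box preserves binary intersections and the whole set,
    together with idempotence of intersection, the fact that the complement of
    the empty set is the whole set, and double complementation. *)

Lemma lower_approxI (W : Type) (E : W -> W -> Prop) (A B : set W) :
  lower_approx E (A `&` B)%classic
  = (lower_approx E A `&` lower_approx E B)%classic.
Proof.
apply/seteqP; split=> [w wAB | w [wA wB] v Ewv]; last by split; auto.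
by split=> v /wAB [].
Qed.

Lemma lower_approxT (W : Type) (E : W -> W -> Prop) :
  lower_approx E setT = setT.
Proof. by apply/seteqP; split. Qed.

Theorem theorem12 (K : context) (KC : kripke_context K)
    (x y : protoconcept K) :
  (fR KC (pmeet x y) = pmeet (fR KC x) (fR KC y) /\
   fS KC (pjoin x y) = pjoin (fS KC x) (fS KC y)) /\
  (fR KC (pmeet x x) = fR KC x /\
   fS KC (pjoin x x) = fS KC x) /\
  (fR KC (pneg (pbot K)) = pneg (pbot K) /\
   fS KC (popp (ptop K)) = popp (ptop K)) /\
  (fR KC (pneg x) = pneg (fR_dual KC x) /\
   fS KC (popp x) = popp (fS_dual KC x)).
Proof.
split; first by rewrite /fR /fS /pmeet /pjoin /= !lower_approxI.
split; first by rewrite /fR /fS /= !setIid.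
split; first by rewrite /fR /fS /pneg /popp /= !setC0 !lower_approxT.
by rewrite /fR_dual /fS_dual /fR /fS /pneg /popp /= !setCK.
Qed.
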